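(* For every $n\ge 4$, $|\mathrm{Sort}_n(123,321)|=7\cdot 2^{n-4}$.
   Context: A permutation $x$ contains a pattern $p$ if it has a subsequence order-isomorphic to $p$; otherwise it avoids $p$. For a set $T$ of patterns, the map $s_T$ is defined as follows: the entries of the input permutation $x=x_1\cdots x_n$ are read from left to right, with an initially empty stack. At each step, if the input is nonempty and pushing the next input entry onto the stack produces a stack whose contents, read from top to bottom, avoid every pattern in $T$, that entry is pushed; otherwise the top entry of the stack is popped and appended to the output. When the input is exhausted, the remaining stack entries are popped one at a time to the output. $s_T(x)$ is the output word. Write $s_{\sigma,\tau}=s_{\{\sigma,\tau\}}$ and $s=s_{\{21\}}$ (West's stack-sorting map, whose stack is increasing from top to bottom). $\mathrm{Sort}_n(\sigma,\tau)$ is the set of $x\in S_n$ such that $s(s_{\sigma,\tau}(x))=12\cdots n$. *)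

(* Defs.v *)
From mathcomp Require Import all_boot all_fingroup.
Set Implicit Arguments. Unset Strict Implicit. Unset Printing Implicit Defensive.

Definition order_iso (s q : seq nat) : bool :=
  (size s == size q) &&
  all (fun i => all (fun j =>
      (nth 0 s i < nth 0 s j) == (nth 0 q i < nth 0 q j))
      (iota 0 (size s))) (iota 0 (size s)).

Fixpoint subseqs (w : seq nat) : seq (seq nat) :=
  match w with
  | [::] => [:: [::]]
  | x :: w' => let r := subseqs w' in [seq x :: s | s <- r] ++ r
  end.

Definition contains (w p : seq nat) : bool := has (fun s => order_iso s p) (subseqs w).
Definition avoids (w p : seq nat) : bool := ~~ contains w p.

(* The stack machine s_T.  The stack is a list whose head is the top,
   so the list itself is the stack contents read from top to bottom.
   [fuel] bounds the number of steps; 2 * size x steps always suffice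
   (every step either pushes an input entry or pops a stack entry). *)
Fixpoint sT_aux (T : seq (seq nat)) (fuel : nat) (inp stk out : seq nat) : seq nat :=
  match fuel with
  | 0 => out ++ stk
  | f.+1 =>
    match inp with
    | [::] => out ++ stk   (* pop the remaining entries one at a time *)
    | a :: inp' =>
      if all (fun p => avoids (a :: stk) p) T then sT_aux T f inp' (a :: stk) out
      else match stk with
           | [::] => sT_aux T f inp' [:: a] out (* unreachable when all patterns have length >= 2 *)
           | b :: stk' => sT_aux T f inp stk' (rcons out b)
           end
    end
  end.

Definition sT (T : seq (seq nat)) (x : seq nat) : seq nat :=
  sT_aux T (2 * size x) x [::] [::].

Definition west_s (x : seq nat) : seq nat := sT [:: [:: 2; 1]] x.

(* the one-line word of a permutation of 'I_n (values 0..n-1) *)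
Definition word n (x : 'S_n) : seq nat := [seq nat_of_ord (x i) | i <- enum 'I_n].

Definition Sort_n (n : nat) (sigma tau : seq nat) : {set 'S_n} :=
  [set x : 'S_n | west_s (sT [:: sigma; tau] (word x)) == iota 0 n].

(* Main.v *)
Require Import Defs.
From mathcomp Require Import all_boot all_fingroup zify.
Set Implicit Arguments. Unset Strict Implicit. Unset Printing Implicit Defensive.

(** West's map sorts a permutation iff it avoids 231, so the output [y] of the
    123,321-avoiding stack on [x] must avoid 231.

    If every remaining entry is smaller than the entries of the stack [B], then the
    part of the stack above [B] has at most two entries and the machine performs one
    pass of bubble sort: it keeps the minimum read so far and outputs everything else.
    As the minimum comes last, 231-avoidance forces the outcome of the pass to be
    decreasing, and exactly [2 ^ (m - 1)] words on [m] letters have this property.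

    Write [x = P ++ M :: w] with [M] the maximum.  The first entry [p] of [x] stays at
    the bottom of the stack, so an entry of [P] above [p] would be output before [M],
    giving 231 with [M] and [p].  Hence [P] undergoes a bubble pass above [p], and
    its minimum [q] lies below [M] in the stack; any other entry of [P] gives 231 with
    [M] and [q].  So [x] is [M :: w], [p :: M :: w] or [p :: q :: M :: w]; in each case
    231-avoidance forces [w] to lie below the other entries and to be sorted by a
    bubble pass, whence [2 ^ (n - 2) + 2 ^ (n - 3) + 2 ^ (n - 4)] permutations. *)

(** * Stack machines driven by a rejection predicate *)

Fixpoint popped (bad : nat -> seq nat -> bool) c st :=
  if st is b :: st' then
    if bad c st then b :: popped bad c st' else [::]
  else [::].

Fixpoint remaining (bad : nat -> seq nat -> bool) c st :=
  if st is b :: st' then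
    if bad c st then remaining bad c st' else st
  else [::].

(** The machine without fuel. [bad c st] says that [st] rejects [c]; reading [c] splits [st] into
    what leaves and what stays, and an empty stack accepts everything. *)
Fixpoint run (bad : nat -> seq nat -> bool) inp st :=
  if inp is c :: inp' then
    popped bad c st ++ run bad inp' (c :: remaining bad c st)
  else st.

Lemma popped_cat_remaining bad c st : popped bad c st ++ remaining bad c st = st.
Proof. by elim: st => //= b st IH; case: ifP => //= _; rewrite IH. Qed.

Lemma run_cons bad c inp b st :
  run bad (c :: inp) (b :: st) =
  if bad c (b :: st) then b :: run bad (c :: inp) st
  else run bad inp [:: c, b & st].
Proof. by rewrite /=; case: ifP. Qed.

Lemma run_nil_stack bad c inp : run bad (c :: inp) [::] = run bad inp [:: c].
Proof. by []. Qed.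

Lemma run_push bad c inp st :
  bad c st = false -> run bad (c :: inp) st = run bad inp (c :: st).
Proof. by case: st => // b st H; rewrite run_cons H. Qed.

(** Stack entries leave from top to bottom, possibly interleaved with input; this supplies late
    letters of the 231 patterns found below. *)
Lemma subseq_run bad inp st : subseq st (run bad inp st).
Proof.
elim: inp st => [|c inp IH] st //=.
rewrite -{1}(popped_cat_remaining bad c st); apply: cat_subseq => //.
exact: subseq_trans (subseq_cons _ _) (IH _).
Qed.

Lemma perm_run bad inp st : perm_eq (run bad inp st) (st ++ inp).
Proof.
elim: inp st => [|c inp IH] st /=; first by rewrite cats0.
rewrite -{3}(popped_cat_remaining bad c st) -catA perm_cat2l.
apply: perm_trans (IH _) _.
by rewrite -cat1s -catA perm_catCA.
Qed.

Lemma remaining_base bad c st B :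
  bad c B = false -> exists st', remaining bad c (st ++ B) = st' ++ B.
Proof.
move=> bB; elim: st => [|b st [st' IH]] /=.
  by exists [::]; case: B bB => //= b B ->.
by case: ifP => _; [exists st' | exists (b :: st)].
Qed.

(** Popping stops at [B] at the latest, as [B] accepts every later entry; so [B] stays at the bottom
    and comes out last. *)
Lemma run_base bad inp st B :
  (forall c, c \in inp -> bad c B = false) ->
  exists2 u, run bad inp (st ++ B) = u ++ B & perm_eq u (st ++ inp).
Proof.
move=> bB.
suff [u E] : exists u, run bad inp (st ++ B) = u ++ B.
  exists u => //; rewrite -(perm_cat2r B) -E.
  apply: perm_trans (perm_run _ _ _) _.
  by rewrite -!catA perm_cat2l perm_catC.
elim: inp st bB => [|c inp IH] st bB /=; first by exists st.
have [st' ->] := remaining_base st (bB c (mem_head _ _)).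
have [u] := IH (c :: st') (fun d dI => bB d (mem_behead (s := c :: inp) dI)).
by move=> /= ->; exists (popped bad c (st ++ B) ++ u); rewrite catA.
Qed.

(** * From [sT] to [run] *)

Definition stack_ok T st := all (fun p => avoids st p) T.

Lemma stack_ok_behead T b st : stack_ok T (b :: st) -> stack_ok T st.
Proof.
apply: sub_all => p; apply: contra; rewrite /contains /= has_cat => ->.
by rewrite orbT.
Qed.

Lemma sT_run T bad x :
  (forall c, bad c [::] = false) -> stack_ok T [::] ->
  (forall c st, stack_ok T st -> stack_ok T (c :: st) = ~~ bad c st) ->
  sT T x = run bad x [::].
Proof.
move=> bad0 ok0 badE; rewrite /sT.
(* Both a push and a pop lower [(size inp).*2 + size st] by one, so this much fuel suffices. *)
suff H f inp st out : stack_ok T st -> (size inp).*2 + size st <= f ->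
    sT_aux T f inp st out = out ++ run bad inp st.
  by rewrite H //= mul2n addn0.
elim: f inp st out => [|f IH] [|c inp] st out ok //=.
move=> le; rewrite -/(stack_ok T (c :: st)) badE //.
case: st ok le => [|b st] ok le /=.
  by rewrite bad0 IH //; [rewrite badE ?bad0 | move: le => /=; lia].
case: ifPn => bb.
  by rewrite (negbTE bb) IH //; [rewrite badE | move: le => /=; lia].
rewrite negbK in bb; rewrite bb IH ?cat_rcons //; last by move: le => /=; lia.
exact: stack_ok_behead ok.
Qed.

(** * Occurrences of 123 and 321 through the top entry *)

Lemma nil_subseqs s : [::] \in subseqs s.
Proof. by elim: s => //= x s IH; rewrite mem_cat IH orbT. Qed.

(** Once all letters of a pattern but the last are fixed, only one-entry subsequences can complete
    it. *)
Lemma has_subseqs1 (P : pred nat) st :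
  has (fun s => if s is [:: d] then P d else false) (subseqs st) = has P st.
Proof.
elim: st => //= d st IH; rewrite has_cat IH has_map; congr (_ || _).
apply/hasP/idP => [[[|e s] _] //|Pd].
by exists [::] => //; exact: nil_subseqs.
Qed.

Fixpoint up2 a s :=
  if s is b :: s' then (a < b) && has (ltn b) s' || up2 a s' else false.

Fixpoint down2 a s :=
  if s is b :: s' then (b < a) && has (gtn b) s' || down2 a s' else false.

Lemma contains_cons c st p :
  contains (c :: st) p = has (fun s => order_iso (c :: s) p) (subseqs st) || contains st p.
Proof. by rewrite /contains /= has_cat has_map. Qed.

Lemma order_iso123 a b c : order_iso [:: a; b; c] [:: 1; 2; 3] = (a < b) && (b < c).
Proof. rewrite /order_iso /=; lia. Qed.

Lemma order_iso321 a b c : order_iso [:: a; b; c] [:: 3; 2; 1] = (b < a) && (c < b).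
Proof. rewrite /order_iso /=; lia. Qed.

Lemma has_order_iso123 c st : has (fun s => order_iso (c :: s) [:: 1; 2; 3]) (subseqs st) = up2 c st.
Proof.
elim: st => //= b st IH; rewrite has_cat IH has_map; congr (_ || _).
under eq_has => s do
  have -> : preim (cons b) (fun s => order_iso (c :: s) [:: 1; 2; 3]) s =
    (if s is [:: d] then (c < b) && (b < d) else false)
    by case: s => [|d [|e s]] //=; rewrite order_iso123.
by rewrite has_subseqs1; case: (c < b) => //=; rewrite has_pred0.
Qed.

Lemma has_order_iso321 c st : has (fun s => order_iso (c :: s) [:: 3; 2; 1]) (subseqs st) = down2 c st.
Proof.
elim: st => //= b st IH; rewrite has_cat IH has_map; congr (_ || _).
under eq_has => s do
  have -> : preim (cons b) (fun s => order_iso (c :: s) [:: 3; 2; 1]) s =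
    (if s is [:: d] then (b < c) && (d < b) else false)
    by case: s => [|d [|e s]] //=; rewrite order_iso321.
by rewrite has_subseqs1; case: (b < c) => //=; rewrite has_pred0.
Qed.

(* Only triples involving [c] count: the stack [st] itself avoids both patterns. *)
Definition mono c st := up2 c st || down2 c st.

Lemma sT_mono x : sT [:: [:: 1; 2; 3]; [:: 3; 2; 1]] x = run mono x [::].
Proof.
apply: sT_run => // c st; rewrite /stack_ok /= !andbT /avoids.
case/andP=> /negbTE o1 /negbTE o2.
by rewrite !contains_cons o1 o2 !orbF has_order_iso123 has_order_iso321 negb_or.
Qed.

(** * West's map and the pattern 231 *)

Definition has_lt c st := has (gtn c) st.

Lemma west_run x : west_s x = run has_lt x [::].
Proof.
apply: sT_run => // c st; rewrite /stack_ok /= !andbT /avoids.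
move=> /negbTE o1; rewrite contains_cons o1 orbF; congr (~~ _).
rewrite /has_lt -has_subseqs1; apply: eq_has => -[|d [|e s]] //=.
by rewrite /order_iso /=; lia.
Qed.

(** Occurrences of 231 in which [a] plays the 2. *)
Fixpoint up_down a s :=
  if s is b :: s' then (a < b) && has (gtn a) s' || up_down a s' else false.

Fixpoint has231 s := if s is a :: s' then up_down a s' || has231 s' else false.

Lemma up_down_subseq a s t : subseq s t -> up_down a s -> up_down a t.
Proof.
elim: t s => [|y t IH] [|x s] //= st.
case: eqP st => [<-|_] st.
  case/orP=> [/andP[-> /hasP[c cs ca]]|/(IH _ st)->]; last by rewrite orbT.
  by apply/orP; left; apply/hasP; exists c => //; exact: (mem_subseq st).
by move=> H; rewrite (IH (x :: s)) ?orbT.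
Qed.

Lemma has231_subseq s t : subseq s t -> has231 s -> has231 t.
Proof.
elim: t s => [|y t IH] [|x s] //= st.
case: eqP st => [<-|_] st.
  by case/orP=> [/(up_down_subseq st)->//|/(IH _ st)->]; rewrite orbT.
by move=> H; rewrite (IH (x :: s)) ?orbT.
Qed.

Lemma has231_triple a b c s : subseq [:: a; b; c] s -> c < a -> a < b -> has231 s.
Proof. by move=> st ca ab; apply: has231_subseq st _; rewrite /= ca ab. Qed.

Lemma up_down_has a s : up_down a s -> has (gtn a) s.
Proof.
elim: s => //= b s IH /orP[/andP[_ ->]|/IH ->]; by rewrite orbT.
Qed.

(** On an increasing stack the entries below [c] form the top part, so [c] expels exactly these. *)
Lemma popped_lt c st : sorted ltn st -> popped has_lt c st = filter (gtn c) st.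
Proof.
elim: st => //= b st IH pb.
rewrite IH ?(path_sorted pb) //= /has_lt /=; case: ltnP => //= cb.
have cst : all (leq c) st.
  apply: sub_all (order_path_min ltn_trans pb) => d /=; lia.
have F : has (gtn c) st = false.
  by apply/negbTE; rewrite -all_predC; apply: sub_all cst => d /=; lia.
rewrite F.
by apply/esym/eqP; move: F; rewrite has_filter => /negbFE.
Qed.

Lemma remaining_lt c st : sorted ltn st -> remaining has_lt c st = filter (leq c) st.
Proof.
elim: st => //= b st IH pb.
rewrite IH ?(path_sorted pb) //= /has_lt /=; case: ltnP => cb //=.
have cst : all (leq c) st.
  apply: sub_all (order_path_min ltn_trans pb) => d /=; lia.
have F : has (gtn c) st = false.
  by apply/negbTE; rewrite -all_predC; apply: sub_all cst => d /=; lia.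
by rewrite F (all_filterP cst).
Qed.

(** The stack is arbitrary for the induction. A stack entry is output too early exactly when a
    larger entry pops it while a smaller one is still unread, so it acts as the 2 of a 231. *)
Lemma sorted_run_lt inp st :
  sorted ltn st -> uniq (st ++ inp) ->
  sorted ltn (run has_lt inp st) =
  ~~ has (fun a => up_down a inp) st && ~~ has231 inp.
Proof.
elim: inp st => [|c inp IH] st ss u /=.
  by rewrite ss andbT; elim: (st).
rewrite popped_lt // remaining_lt //.
set lo := filter (gtn c) st; set hi := filter (leq c) st.
have chi : c \notin hi.
  by rewrite mem_filter negb_and; move: u; rewrite cat_uniq /= negb_or;
     case/and4P=> _ /andP[-> _]; rewrite orbT.
have shi : sorted ltn (c :: hi).
  rewrite /= path_sortedE; last exact: ltn_trans.
  rewrite (sorted_filter ltn_trans) // andbT; apply/allP => d.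
  move=> dh; have := dh; rewrite mem_filter => /andP[cd _].
  by rewrite /= ltn_neqAle cd andbT; apply: contraNneq chi => ->.
have uhi : uniq ((c :: hi) ++ inp).
  have : subseq (hi ++ c :: inp) (st ++ c :: inp).
    by apply: cat_subseq (subseq_refl _); exact: filter_subseq.
  move/subseq_uniq/(_ u); rewrite -(perm_uniq (s1 := (c :: hi) ++ inp)) //.
  by rewrite -cat1s -catA perm_catCA.
(* Popped entries must be below all that follows; [c :: hi] already lies above [lo], so only unread
   input matters. *)
have -> : sorted ltn (lo ++ run has_lt inp (c :: hi)) =
   sorted ltn (run has_lt inp (c :: hi)) && ~~ has (fun a => has (gtn a) inp) lo.
  have -> : ~~ has (fun a => has (gtn a) inp) lo =
            allrel ltn lo (run has_lt inp (c :: hi)).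
    apply/hasPn/allrelP => [H a d alo | H a alo].
      rewrite (perm_mem (perm_run _ _ _)) /= inE mem_cat.
      have := alo; rewrite mem_filter /= => /andP[ac ast].
      case/or3P=> [/eqP->//|dhi|dinp].
        by move: dhi; rewrite mem_filter /= => /andP[cd _]; lia.
      have := H a alo; rewrite -all_predC => /allP/(_ _ dinp) /=.
      rewrite -leqNgt leq_eqVlt => /orP[/eqP E|//].
      move: u; rewrite cat_uniq => /and3P[_ /hasPn/(_ d)].
      by rewrite inE dinp orbT -E /= ast => /(_ isT).
    rewrite -all_predC; apply/allP => d dinp /=.
    rewrite -leqNgt; apply/ltnW/H => //.
    by rewrite (perm_mem (perm_run _ _ _)) mem_cat dinp orbT.
  rewrite !(sorted_pairwise ltn_trans) pairwise_cat -!(sorted_pairwise ltn_trans).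
  by rewrite (sorted_filter ltn_trans) // andbC /=.
rewrite IH //= !negb_or.
(* For [a < c] the entry [c] is the 3, and any later entry below [a] completes a 231; for [a] in
   [hi] the 3 must come after [c]. *)
have -> : has (fun a => (a < c) && has (gtn a) inp || up_down a inp) st =
   has (fun a => has (gtn a) inp) lo || has (fun a => up_down a inp) hi.
  apply/hasP/orP => [[a ast]|[] /hasP[a]].
  - case: (ltnP a c) => /= [ac|ca] H; [left|right]; apply/hasP; exists a.
    + by rewrite mem_filter /= ac.
    + by case/orP: H => // /up_down_has.
    + by rewrite mem_filter /= ca.
    + by [].
  - rewrite mem_filter /= => /andP[ac ast] H.
    by exists a => //; rewrite ac H.
  - rewrite mem_filter /= => /andP[ac ast] H.
    by exists a => //; rewrite H orbT.
rewrite negb_or.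
by case: (up_down c inp); case: (has231 inp); case: (has _ lo); case: (has _ hi).
Qed.

Lemma west_sorts (y : seq nat) n : perm_eq y (iota 0 n) -> (west_s y == iota 0 n) = ~~ has231 y.
Proof.
move=> py; rewrite west_run.
have uy : uniq y by rewrite (perm_uniq py) iota_uniq.
rewrite -[RHS](sorted_run_lt (st := [::])) //.
apply/eqP/idP => [->|s]; first exact: iota_ltn_sorted.
apply: (sorted_eq ltn_trans) => //.
- by move=> a b /andP[]; lia.
- exact: iota_ltn_sorted.
- by rewrite (permPl (perm_run _ _ _)).
Qed.

(** * The bubble pass and the words it makes decreasing *)

Fixpoint bubble_out b w :=
  if w is c :: w' then maxn b c :: bubble_out (minn b c) w' else [::].

Definition bubble w :=
  if w is b :: w' then rcons (bubble_out b w') (foldl minn b w') else [::].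

Lemma bubble_cons2 b c w : bubble [:: b, c & w] = maxn b c :: bubble (minn b c :: w).
Proof. by []. Qed.

Lemma perm_bubble w : perm_eq (bubble w) w.
Proof.
case: w => // b w; elim: w b => // c w IH b; rewrite bubble_cons2.
apply: perm_trans (_ : perm_eq _ (maxn b c :: minn b c :: w)) _; first by rewrite perm_cons.
case: leqP => // _; apply/seq.permP => p /=; lia.
Qed.

Lemma bubble_min_le b w : foldl minn b w <= b.
Proof. by elim: w b => //= c w IH b; apply: leq_trans (IH _) _; lia. Qed.

Lemma bubble_out_gt b w : uniq (b :: w) -> all (ltn (foldl minn b w)) (bubble_out b w).
Proof.
elim: w b => //= c w IH b /andP[]; rewrite inE negb_or => /andP[bc bw] /andP[cw uw].
have := bubble_min_le (minn b c) w => le.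
rewrite IH ?andbT; first by lia.
by rewrite /= uw andbT; case: leqP.
Qed.

(** A 321 through [b] would need an entry of [B] below [b]; a 123 through [b] needs only [c < b], as
    the entries of the nonempty [B] are above [b]. *)
Lemma mono_cons_small B c b :
  B != [::] -> all (ltn b) B -> mono c B = false -> mono c (b :: B) = (c < b).
Proof.
case: B => // e B _ bB; rewrite /mono [up2 c (b :: _)]/= [down2 c (b :: _)]/=.
move=> /norP[/negbTE u /negbTE d]; rewrite -/(up2 c (e :: B)) -/(down2 c (e :: B)).
have -> : (gtn b e || has (gtn b) B) = false.
  by apply/negbTE; rewrite -[_ || _]/(has (gtn b) (e :: B)) -all_predC;
     apply: sub_all bB => x /=; lia.
by move: u d => /= -> ->; move: bB => /= /andP[-> _]; rewrite andbT andbF !orbF.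
Qed.

(* Whatever is read next, the entry [d] above [b] is popped: a smaller entry makes 123
   with [B], a larger one makes 321 with [b]. *)
Lemma run_pop_top B b d inp :
  B != [::] -> b < d -> all (ltn d) B -> d \notin inp ->
  run mono inp [:: d, b & B] = d :: run mono inp (b :: B).
Proof.
case: inp => // c inp B0 bd dB; rewrite inE negb_or => /andP[dc _].
rewrite run_cons; suff -> : mono c [:: d, b & B] by [].
case: B B0 dB => // e B _ /= /andP[/= de _]; rewrite /mono /= bd de !orbT !andbT.
by case: ltngtP dc => //=; rewrite !orbT.
Qed.

(** A smaller entry [c] expels [b] and takes its place; a larger one is pushed onto [b] and is the
    next to leave, by [run_pop_top]. Either way [maxn b c] goes out and [minn b c] stays. *)
Lemma run_bubble B b w z :
  B != [::] -> uniq (b :: w ++ z) -> allrel ltn (b :: w) B ->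
  (forall c, c \in w -> mono c B = false) ->
  run mono (w ++ z) (b :: B) = bubble_out b w ++ run mono z (foldl minn b w :: B).
Proof.
move=> B0; elim: w b => [|c w IH] b // u; rewrite !allrel_consl => /and3P[bB cB wB] mB.
have mc := mB c (mem_head _ _).
have mw d : d \in w -> mono d B = false by move=> dw; apply: mB; rewrite inE dw orbT.
rewrite /= inE negb_or in u; case/and3P: u => /andP[bc bw] cw uw.
rewrite cat_cons run_cons mono_cons_small // [bubble_out _ _]/= [foldl _ _ _]/=.
case: ltnP => cb.
  by rewrite run_push // IH //= ?allrel_consl ?cB ?cw.
rewrite run_pop_top //; last by lia.
by rewrite IH //= ?allrel_consl ?bB ?bw.
Qed.

Lemma run_bubble_all B w :
  B != [::] -> uniq w -> allrel ltn w B ->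
  (forall c, c \in w -> mono c B = false) -> run mono w B = bubble w ++ B.
Proof.
case: w => // b w B0 u wB mB; rewrite run_push ?mB ?mem_head //.
rewrite -[w in run _ w _]cats0 run_bubble ?cats0 // ?cat_rcons //.
by move=> c cw; apply: mB; rewrite inE cw orbT.
Qed.

(* Bubble sorting outputs the maximum first, so the maximum of the word is
   its first or second entry. *)
Fixpoint bubble_words m : seq (seq nat) :=
  if m is m'.+1 then
    if m' is 0 then [:: [:: 0]] else
    [seq m' :: w | w <- bubble_words m'] ++
    [seq head 0 w :: m' :: behead w | w <- bubble_words m']
  else [:: [::]].

Lemma rev_iotaS m : rev (iota 0 m.+1) = m :: rev (iota 0 m).
Proof. by rewrite -addn1 iotaD rev_cat. Qed.

Lemma size_bubble_words m : size (bubble_words m.+1) = 2 ^ m.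
Proof.
by elim: m => // m IH; rewrite [bubble_words _]/= size_cat !size_map IH expnS; lia.
Qed.

Lemma bubble_eq_perm w m : bubble w = rev (iota 0 m) -> perm_eq w (iota 0 m).
Proof.
by move=> E; rewrite -(permPl (perm_bubble w)) E perm_rev.
Qed.

Lemma bubble_wordsP w m : (w \in bubble_words m) = (bubble w == rev (iota 0 m)).
Proof.
elim: m w => [|[|m] IH] w.
- by case: w => // b w; rewrite /= inE; case: (bubble_out _ _).
- case: w => [|b [|c w]]; rewrite inE //.
  rewrite bubble_cons2 !eqseq_cons andbF /=.
  by case: (bubble_out _ _) => *; rewrite andbF.
rewrite rev_iotaS.
have lt v x : v \in bubble_words m.+1 -> x \in v -> x < m.+1.
  rewrite IH => /eqP/bubble_eq_perm/perm_mem ->; by rewrite mem_iota.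
rewrite [bubble_words _]/= -[(if m is 0 then _ else _)]/(bubble_words m.+1) mem_cat.
apply/orP/idP.
  case=> /mapP[v vA ->].
    case: v vA (vA) => [|c v]; first by rewrite IH rev_iotaS.
    move=> vA; have := lt _ c vA (mem_head _ _) => cm.
    rewrite IH bubble_cons2 => /eqP E.
    have -> : minn m.+1 c = c by lia.
    by rewrite E; have -> : maxn m.+1 c = m.+1 by lia.
  case: v vA (vA) => [|c v]; first by rewrite IH rev_iotaS.
  move=> vA; have := lt _ c vA (mem_head _ _) => cm.
  rewrite IH [head _ _]/= [behead _]/= bubble_cons2 => /eqP E.
  have -> : minn c m.+1 = c by lia.
  by rewrite E; have -> : maxn c m.+1 = m.+1 by lia.
case: w => [|b [|c w]] //; first by rewrite rev_iotaS [bubble _]/= eqseq_cons andbF.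
(* The first comparison outputs the larger of [b] and [c], which must be [m.+1]; the smaller one
   followed by [w] is the shorter word. *)
rewrite bubble_cons2 eqseq_cons -IH => /andP[/eqP E vA].
case: (leqP b c) E vA => [bc ->|cb ->] vA; [right|left]; apply/mapP.
  by exists (b :: w).
by exists (c :: w).
Qed.

Lemma uniq_bubble_words m : uniq (bubble_words m).
Proof.
elim: m => // -[|m] // IH.
rewrite [bubble_words _]/= -[(if m is 0 then _ else _)]/(bubble_words m.+1).
have lt v : v \in bubble_words m.+1 -> exists c v', v = c :: v' /\ c < m.+1.
  rewrite bubble_wordsP => /eqP/bubble_eq_perm p.
  case: v p => [|c v] p; first by have := perm_size p.
  by exists c, v; split => //; have := perm_mem p c; rewrite mem_head mem_iota.
rewrite cat_uniq map_inj_uniq ?IH; last by move=> u v [].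
rewrite map_inj_in_uniq ?IH ?andbT /=; last first.
  by move=> u v /lt[c [u' [-> _]]] /lt[d [v' [-> _]]] /= [-> ->].
(* The first family starts with [m.+1], the second with a smaller letter. *)
apply/hasPn => v /mapP[u /lt[c [u' [-> cm]]] ->] /=.
by apply/mapP => -[t _ [E _]]; lia.
Qed.

(** * Decreasing prefixes and avoidance of 231 *)

Lemma up_down_cat a s t : all (gtn a) s -> up_down a (s ++ t) = up_down a t.
Proof.
elim: s => //= b s IH /andP[ba sa]; rewrite IH //.
by case: ltnP => //; lia.
Qed.

Lemma up_down_gt a t : all (ltn a) t -> up_down a t = false.
Proof.
move=> at_; apply/negbTE; apply: contraL at_ => /up_down_has/hasP[x xt xa].
by apply/allPn; exists x => //=; rewrite /= in xa; lia.
Qed.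

Lemma up_down_lt a t : all (gtn a) t -> up_down a t = false.
Proof. by move=> at_; rewrite -[t]cats0 up_down_cat. Qed.

(** No entry of [s] can play the 2: larger entries follow it only in [t], where nothing is
    smaller. *)
Lemma has231_decr_cat s t :
  sorted gtn s -> allrel ltn s t -> has231 (s ++ t) = has231 t.
Proof.
have gtr : transitive gtn by move=> a b c /=; lia.
elim: s => // a s IH /=; rewrite (path_sortedE gtr) allrel_consl.
case/andP=> sa ss /andP[at_ st]; rewrite IH // up_down_cat //.
by rewrite up_down_gt.
Qed.

(** Entries [a < b] of [u] in this order form a 231 with the final minimum [m]. *)
Lemma decr_of_no231 u m :
  ~~ has231 (rcons u m) -> all (ltn m) u -> uniq u -> sorted gtn (rcons u m).
Proof.
have gtr : transitive gtn by move=> a b c /=; lia.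
elim: u => //= a u IH; rewrite negb_or => /andP[na nu] /andP[ma mu] /andP[au uu].
rewrite (path_sortedE gtr) IH // andbT all_rcons /= ma.
apply/allP => b bu /=; rewrite ltnNge; apply/negP => ab; case/negP: na.
apply: (up_down_subseq (s := [:: b; m])).
  by rewrite -cats1 -[[:: b; m]]/([:: b] ++ [:: m]) cat_subseq // sub1seq.
rewrite /= ma andbF !orbF andbT ltn_neqAle ab andbT.
by apply: contraNneq au => ->.
Qed.

(** The pass ends with its minimum, so its output is decreasing, and [rev (iota 0 m)] is the only
    decreasing arrangement of these letters. *)
Lemma bubble_no231 w m t :
  perm_eq w (iota 0 m) -> ~~ has231 (bubble w ++ t) -> w \in bubble_words m.
Proof.
move=> pw; have uw : uniq w by rewrite (perm_uniq pw) iota_uniq.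
have gtr : transitive gtn by move=> a b c /=; lia.
move=> nw; have {nw} : ~~ has231 (bubble w).
  by apply: contra nw; apply: has231_subseq; exact: prefix_subseq.
rewrite bubble_wordsP => nw.
have s : sorted gtn (bubble w).
  case: w pw uw nw => // b w _ ubw nw; apply: decr_of_no231 => //.
    exact: bubble_out_gt.
  have := perm_uniq (perm_bubble (b :: w)); rewrite ubw /= rcons_uniq.
  by case/andP.
apply/eqP; apply: (sorted_eq gtr) => //.
- by move=> a b /=; lia.
- by rewrite rev_sorted; exact: iota_ltn_sorted.
- by rewrite (permPl (perm_bubble w)) (permPl pw) perm_sym perm_rev.
Qed.

(** * Entries read before the maximum *)

Lemma mono1 c p : mono c [:: p] = false.
Proof. by rewrite /mono /= !andbF. Qed.

Lemma mono2 c M p : p < M -> c < M -> mono c [:: M; p] = false.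
Proof. by rewrite /mono /=; lia. Qed.

Lemma subseq2_cat (T : eqType) (a b : T) (s t : seq T) :
  a \in s -> b \in t -> subseq [:: a; b] (s ++ t).
Proof.
by move=> as_ bt; rewrite -[[:: a; b]]/([:: a] ++ [:: b]) cat_subseq // sub1seq.
Qed.

Lemma subseq3_cat (T : eqType) (a b c : T) (s t : seq T) :
  a \in s -> subseq [:: b; c] t -> subseq [:: a; b; c] (s ++ t).
Proof.
by move=> as_ bt; rewrite -[[:: a; b; c]]/([:: a] ++ [:: b; c]) cat_subseq // sub1seq.
Qed.

Lemma run_before_bottom a inp st p : a \in inp -> subseq [:: a; p] (run mono inp (rcons st p)).
Proof.
move=> ai; rewrite -cats1.
have [c _|u -> pu] := @run_base mono inp st [:: p]; first exact: mono1.
by apply: subseq2_cat; rewrite ?mem_head // (perm_mem pu) mem_cat ai orbT.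
Qed.

(** From top to bottom [M], [e], [p] would form a 321, so [e] must leave before [M] enters. *)
Lemma popped_descent M e p st :
  p < e < M -> e \in st -> e \in popped mono M (rcons st p).
Proof.
move=> /andP[pe eM]; elim: st => //= b st IH; rewrite inE.
have H : e \in b :: st -> mono M (b :: rcons st p).
  move=> est; rewrite /mono -rcons_cons; apply/orP; right.
  elim: (b :: st) est => //= d s IHs; rewrite inE => /orP[/eqP <-|/IHs ->].
    by rewrite eM has_rcons /= pe.
  by rewrite orbT.
rewrite -in_cons => est; rewrite H //; move: est; rewrite !inE => /orP[->//|/IH ->].
by rewrite orbT.
Qed.

(** The entry [e] leaves when [M] is read at the latest, while [p] stays at the bottom, below
    [M]. *)
Lemma large_before_max M e p P w st :
  p < e < M -> e \in st ++ P ->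
  subseq [:: e; M; p] (run mono (P ++ M :: w) (rcons st p)).
Proof.
move=> pem; elim: P st => [|c P IH] st.
  rewrite cats0 => est /=; apply: subseq3_cat; first exact: popped_descent.
  have [] := @remaining_base mono M st [:: p]; first exact: mono1.
  move=> st'; rewrite -cats1 => ->; apply: subseq_trans (subseq_run _ _ _).
  by rewrite -cat_cons; apply: subseq2_cat; exact: mem_head.
move=> est /=; have [] := @remaining_base mono c st [:: p]; first exact: mono1.
move=> st'; rewrite !cats1 => E; have Mi : M \in P ++ M :: w by rewrite mem_cat mem_head orbT.
(* Either [e] leaves while [c] is read, or it is in the stack or the input afterwards. *)
have: e \in popped mono c (rcons st p) \/ e \in (c :: st') ++ P.
  move: est; rewrite mem_cat inE => /or3P[est|/eqP->|eP]; first last.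
  - by right; rewrite mem_cat eP orbT.
  - by right; rewrite mem_cat mem_head.
  have: e \in rcons st p by rewrite mem_rcons inE est orbT.
  rewrite -{1}(popped_cat_remaining mono c (rcons st p)) mem_cat => /orP[->|]; first by left.
  rewrite E mem_rcons inE => /orP[/eqP ep|es]; first by lia.
  by right; rewrite mem_cat inE es orbT.
rewrite E -rcons_cons => -[ep|es].
  by apply: subseq3_cat => //; exact: run_before_bottom.
exact: subseq_trans (IH _ es) (suffix_subseq _ _).
Qed.

Lemma mono_cat c st B : mono c B -> mono c (st ++ B).
Proof.
by move=> m; elim: st => //= b st; rewrite /mono /= => /orP[]->; rewrite !orbT.
Qed.

(** A forbidden triple formed by [c] and two entries of [B] persists under any stack above [B], so
    all of [st] is popped. *)
Lemma remaining_mono_cat c st B :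
  mono c B -> remaining mono c (st ++ B) = remaining mono c B.
Proof. by move=> m; elim: st => //= b st ->; rewrite -cat_cons mono_cat. Qed.

(* The entry right above the bottom only ever decreases, so it stays below [q]. *)
Lemma large_before_small q e c p w st :
  c < q < p -> q < e -> e \in st ++ w ->
  exists2 d, d < q & subseq [:: e; d] (run mono w (st ++ [:: c; p])).
Proof.
move=> cqp qe; elim: w c cqp st => [|f w IH] c cqp st.
  rewrite cats0 => est; exists c; first by lia.
  by apply: subseq2_cat; rewrite ?mem_head.
rewrite mem_cat inE => /or3P[est|/eqP ef|ew].
- exists c; first by lia.
  apply: subseq_trans (subseq_run _ _ _).
  by apply: subseq2_cat; rewrite ?mem_head.
- exists c; first by lia.
  rewrite -ef /=; have [] := @remaining_base mono e st [:: c; p].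
    by rewrite /mono /=; lia.
  move=> st' ->; apply: subseq_trans (suffix_subseq _ _).
  apply: subseq_trans (subseq_run _ _ _); rewrite -cat_cons.
  by apply: subseq2_cat; exact: mem_head.
(* If [f] dislodges [c], then [f < c < p] is a 123 and [f] becomes the entry right above [p];
   otherwise [c] stays there. *)
have [d dq [st' E]] : exists2 d, d < q &
    exists st', f :: remaining mono f (st ++ [:: c; p]) = st' ++ [:: d; p].
  case m : (mono f [:: c; p]).
    exists f; first by move: m; rewrite /mono /=; lia.
    by exists [::]; rewrite remaining_mono_cat //= m mono1.
  have [st' ->] := @remaining_base mono f st _ m.
  by exists c; [lia | exists (f :: st')].
have dqp : d < q < p by lia.
have [d' d'q sub] := IH d dqp st' (etrans (mem_cat _ _ _) (introT orP (or_intror ew))).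
by exists d' => //=; rewrite E; apply: subseq_trans sub (suffix_subseq _ _).
Qed.

Lemma prefix_before_max (p M : nat) (P w : seq nat) :
  uniq (p :: P ++ M :: w) -> all (gtn M) (p :: P) ->
  ~~ has231 (run mono (p :: P ++ M :: w) [::]) ->
  P = [::] \/ exists2 q, P = [:: q] & q < p.
Proof.
move=> u lt; rewrite run_nil_stack => n.
have Pp c : c \in P -> c < p.
  move=> cP; rewrite ltnNge leq_eqVlt; apply/negP => /orP[/eqP pc|pc].
    by move: u; rewrite /= pc mem_cat cP.
  case/negP: n; apply: (@has231_triple c M p) => //.
    apply: (@large_before_max _ _ _ _ _ [::]) => //; rewrite pc /=.
    by move: lt => /= /andP[_ /allP]; exact.
  by move: lt => /= /andP[_ /allP]; exact.
case: P u lt n Pp => [|q P]; first by left.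
move=> u lt n Pp; right; exists q; last by apply: Pp; rewrite mem_head.
case: P u lt n Pp => // c P u lt n Pp; case/negP: n.
rewrite cat_cons run_push ?mono1 //.
have uq : uniq (q :: c :: P).
  move: u; rewrite cons_uniq => /andP[_]; apply: subseq_uniq.
  exact: prefix_subseq.
rewrite run_bubble //; first last.
- by move=> *; exact: mono1.
- rewrite allrel1r; apply/allP => x; exact: Pp.
- by move: u => /= /andP[].
(* With two entries [q], [c] at the head of the prefix, [o] is output before [M] is pushed onto the
   minimum [m], and [o], [M], [m] is a 231. *)
set m := foldl _ _ _; set o := maxn q c.
have mo : m < o by case/andP: (bubble_out_gt uq).
have oM : o < M by move: lt => /= /and4P[_ qM cM _]; rewrite /o; lia.
have mM : mono M [:: m; p] = false.
  have := bubble_min_le q (c :: P); rewrite -/m => mq.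
  have qp := Pp q (mem_head _ _).
  by rewrite /mono /=; lia.
apply: (@has231_triple o M m) => //.
apply: subseq3_cat; first exact: mem_head.
rewrite run_push //; apply: subseq_trans (subseq_run _ _ _).
by rewrite /= !eqxx.
Qed.

(** * The list of sortable words *)

Lemma perm_iota_max m a w :
  perm_eq (a :: w) (iota 0 m.+1) -> all (gtn a) w -> a = m /\ perm_eq w (iota 0 m).
Proof.
move=> p aw.
have am : a = m.
  have : m \in a :: w by rewrite (perm_mem p) mem_iota leq0n ltnSn.
  have : a < m.+1 by have := perm_mem p a; rewrite mem_head mem_iota => /esym.
  rewrite inE => am /orP[/eqP//|/(allP aw) /=]; lia.
split=> //; rewrite -(perm_cons a) (permPl p) am -addn1 iotaD cats1.
by rewrite perm_rcons.
Qed.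

(** Words on [n.+4] letters, by the position of the maximum [n.+3]. *)
Definition sortable_words n :=
  [seq n.+3 :: w | w <- bubble_words n.+3] ++
  [seq [:: n.+2, n.+3 & w] | w <- bubble_words n.+2] ++
  [seq [:: n.+2, n.+1, n.+3 & w] | w <- bubble_words n.+1].

Lemma allrel_iota w m B :
  perm_eq w (iota 0 m) -> all (leq m) B -> allrel ltn w B.
Proof.
move=> pw mB; apply/allrelP => x y; rewrite (perm_mem pw) mem_iota => xm /(allP mB) /=.
lia.
Qed.

Lemma sorted_rev_iota m : sorted gtn (rev (iota 0 m)).
Proof. by rewrite rev_sorted; exact: iota_ltn_sorted. Qed.

Lemma has231_cons a s : has231 (a :: s) = up_down a s || has231 s.
Proof. by []. Qed.

Lemma has231_rev_iota_cat m t : all (leq m) t -> has231 (rev (iota 0 m) ++ t) = has231 t.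
Proof.
move=> mt; rewrite has231_decr_cat ?sorted_rev_iota //.
by apply: allrel_iota mt; rewrite perm_rev.
Qed.

Lemma sortable_words_no231 n x : x \in sortable_words n -> ~~ has231 (run mono x [::]).
Proof.
rewrite !mem_cat => /or3P[] /mapP[w]; rewrite bubble_wordsP => /eqP bw ->;
  have pw := bubble_eq_perm bw; have uw : uniq w by rewrite (perm_uniq pw) iota_uniq.
- have lt : all (gtn n.+3) w by apply/allP => c; rewrite (perm_mem pw) mem_iota.
  rewrite run_nil_stack run_bubble_all //; first last.
  + by move=> *; exact: mono1.
  + by apply: (allrel_iota pw); rewrite /= leqnn.
  by rewrite bw has231_rev_iota_cat //= leqnn.
- have lt c : c \in w -> c < n.+3 by rewrite (perm_mem pw) mem_iota; lia.
  rewrite run_nil_stack run_push ?mono1 // run_bubble_all //=; first last.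
  + by move=> c /lt cn; apply: mono2.
  + by apply: (allrel_iota pw) => /=; lia.
  by rewrite bw has231_rev_iota_cat //=; lia.
case: w bw pw uw => [|c w]; first by move=> _ /perm_size.
move=> bw pw uw.
have lt d : d \in c :: w -> d < n.+1 by rewrite (perm_mem pw) mem_iota.
have cn := lt c (mem_head _ _).
rewrite run_nil_stack run_push ?mono1 // run_push; last by rewrite /mono /=; lia.
(* As [c < n.+1 < n.+2] is a 123, the first letter of the tail pops both [n.+3] and [n.+1]. *)
have -> : run mono (c :: w) [:: n.+3; n.+1; n.+2] =
          [:: n.+3, n.+1 & run mono (c :: w) [:: n.+2]].
  rewrite run_cons; have -> : mono c [:: n.+3; n.+1; n.+2] by rewrite /mono /=; lia.
  by rewrite run_cons; have -> : mono c [:: n.+1; n.+2] by rewrite /mono /=; lia.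
rewrite run_bubble_all //; first last.
+ by move=> *; exact: mono1.
+ by apply: (allrel_iota pw) => /=; lia.
rewrite bw 2!has231_cons; set r := rev _.
have lt' d : d \in r -> d < n.+1 by rewrite mem_rev mem_iota.
(* Neither [n.+3] nor [n.+1] can play the 2: the former is maximal, and the only later entry above
   the latter is [n.+2], which comes last. *)
apply/norP; split; last (apply/norP; split).
+ rewrite up_down_lt //= all_cat /= !andbT; apply/andP; split; first by lia.
  by apply/andP; split; [apply/allP => d /lt' /=; lia | lia].
+ rewrite up_down_cat /= ?andbF //.
  by apply/allP => d /lt' /=; lia.
by rewrite has231_rev_iota_cat //=; lia.
Qed.

Lemma no231_sortable_words n x :
  perm_eq x (iota 0 n.+4) -> ~~ has231 (run mono x [::]) -> x \in sortable_words n.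
Proof.
move=> px; have ux : uniq x by rewrite (perm_uniq px) iota_uniq.
have : n.+3 \in x by rewrite (perm_mem px) mem_iota leq0n ltnSn.
have le a : a \in x -> a <= n.+3 by rewrite (perm_mem px) mem_iota.
set M := n.+3 => Mx; case/splitPr: Mx px ux le => P w px ux le.
have PM : all (gtn M) P.
  apply/allP => a aP; rewrite /= ltn_neqAle le ?mem_cat ?aP // andbT.
  by apply: contraTneq ux => aM; rewrite cat_uniq /= -aM aP !andbF.
have wM : all (gtn M) w.
  apply/allP => a aw; rewrite /= ltn_neqAle le ?mem_cat ?inE ?aw ?orbT // andbT.
  by apply: contraTneq ux => aM; rewrite cat_uniq /= -aM aw !andbF.
have uw : uniq w.
  by apply: subseq_uniq ux; apply: subseq_trans (suffix_subseq _ _); exact: subseq_cons.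
rewrite !mem_cat; case: P px ux le PM => [|p P] px ux le PM.
  have [_ pw] := perm_iota_max px wM.
  rewrite run_nil_stack run_bubble_all //; first last.
  - by move=> *; exact: mono1.
  - by rewrite allrel1r.
  by move/(bubble_no231 pw) => ww; apply/orP; left; apply/mapP; exists w.
move=> nx; have [P0|[q P1 qp]] := prefix_before_max ux PM nx; subst P.
  have pM : p < M by move: PM; rewrite /= andbT.
  move: nx; rewrite run_nil_stack run_push ?mono1 // => nx.
  (* The stack [[:: M; p]] never moves, so an entry [c > p] comes out before it and [c], [M], [p] is
     a 231. *)
  have wp : all (gtn p) w.
    have [|u E pu] := @run_base mono w [::] [:: M; p].
      by move=> c /(allP wM); exact: mono2.
    apply/allP => c cw; rewrite /= ltnNge leq_eqVlt; apply/negP => /orP[/eqP pc|pc].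
      by move: ux; rewrite /= inE pc cw orbT.
    case/negP: nx; rewrite E; apply: (@has231_triple c M p) => //; last exact: (allP wM).
    by apply: subseq3_cat => //; rewrite (perm_mem pu).
  (* With the maximum in front, [perm_iota_max] strips the letters in decreasing order. *)
  have {}px : perm_eq (M :: p :: w) (iota 0 n.+4).
    by rewrite -(permPr px); apply/seq.permP => f /=; lia.
  have [|_ {}px] := perm_iota_max px; first by rewrite /= pM.
  have [pE pw] := perm_iota_max px wp.
  apply/or3P/Or32/mapP; exists w; last by rewrite pE.
  apply: (bubble_no231 (t := [:: M; p])) => //; rewrite -run_bubble_all //.
    by apply/allrelP => a b aw; rewrite !inE => /orP[] /eqP ->; [exact: (allP wM) | exact: (allP wp)].
  by move=> c /(allP wM); exact: mono2.
have [pM qM] : p < M /\ q < M by case/and3P: PM.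
move: nx; rewrite run_nil_stack run_push ?mono1 // run_push; last by rewrite /mono /=; lia.
(* Three of the [n.+4] letters are used, so the tail has a first entry [c]. *)
have: size w = n.+1 by move: (perm_size px); rewrite size_iota /=; case.
case: w px ux le wM uw => // c w px ux le wM uw _ nx.
(* Otherwise [c] is pushed onto [M], and [c], [M], [q] come out as a 231. *)
have cq : c < q.
  rewrite ltnNge leq_eqVlt; apply/negP => /orP[/eqP qc|qc].
    by move: ux; rewrite /= !inE qc eqxx !orbT andbF.
  case/negP: nx; rewrite run_push; last by rewrite /mono /=; move: wM => /=; lia.
  apply: (@has231_triple c M q) => //; last by move: wM => /= /andP[].
  by apply: subseq_trans (subseq_run _ _ _); rewrite /= !eqxx.
have E : run mono (c :: w) [:: M; q; p] = [:: M, q & run mono (c :: w) [:: p]].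
  rewrite run_cons; have -> : mono c [:: M; q; p] by rewrite /mono /=; lia.
  by rewrite run_cons; have -> : mono c [:: q; p] by rewrite /mono /=; lia.
have {E} nx : ~~ has231 (q :: run mono (c :: w) [:: p]).
  by apply: contra nx => H; rewrite E has231_cons H orbT.
(* An entry [e > q] of [w] would be output after [q] and before some [d < q], by
   [large_before_small]: [q], [e], [d] is a 231. *)
have wq : all (gtn q) (c :: w).
  rewrite /= cq; apply/allP => e ew; rewrite /= ltnNge leq_eqVlt.
  apply/negP => /orP[/eqP qe|qe].
    by move: ux; rewrite /= !inE qe ew !orbT andbF.
  have [|d dq sub] := @large_before_small q e c p w [::] _ qe ew; first by rewrite cq.
  case/negP: nx; rewrite run_push ?mono1 //; apply: (@has231_triple q e d) => //.
  by rewrite /= eqxx.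
have {}px : perm_eq [:: M, p, q, c & w] (iota 0 n.+4).
  by rewrite -(permPr px); apply/seq.permP => f /=; lia.
have wp : all (gtn p) (c :: w) by apply: sub_all wq => e /=; lia.
have [|_ {}px] := perm_iota_max px; first by rewrite /= pM qM.
have [|pE {}px] := perm_iota_max px; first by rewrite [all _ _]/= qp.
have [qE pw] := perm_iota_max px wq.
apply/or3P/Or33/mapP; exists (c :: w); last by rewrite pE qE.
apply: (bubble_no231 (t := [:: p])) => //; rewrite -run_bubble_all //.
- by apply: contra nx => H; rewrite has231_cons H orbT.
- by rewrite allrel1r.
- by move=> *; exact: mono1.
Qed.

Lemma perm_sortable_words n x : x \in sortable_words n -> perm_eq x (iota 0 n.+4).
Proof.
have iotaS m : perm_eq (m :: iota 0 m) (iota 0 m.+1).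
  by rewrite -[m.+1]addn1 iotaD cats1 perm_sym perm_rcons.
have consS m w : perm_eq w (iota 0 m) -> perm_eq (m :: w) (iota 0 m.+1).
  by rewrite -(permPr (iotaS m)) perm_cons.
rewrite !mem_cat => /or3P[] /mapP[w]; rewrite bubble_wordsP => /eqP/bubble_eq_perm pw ->.
- exact: consS.
- have := consS _ _ (consS _ _ pw); apply: perm_trans; apply/seq.permP => f /=; lia.
- have := consS _ _ (consS _ _ (consS _ _ pw)); apply: perm_trans.
  by apply/seq.permP => f /=; lia.
Qed.

Lemma uniq_sortable_words n : uniq (sortable_words n).
Proof.
rewrite /sortable_words !cat_uniq !map_inj_uniq ?uniq_bubble_words /=;
  try by move=> u v [].
(* The three families already differ in their first two letters. *)
rewrite has_cat negb_or andbT -!all_predC -andbA; apply/and3P; split;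
  apply/allP => x /mapP[w _ ->] /=; apply/mapP => -[v _ []]; lia.
Qed.

Lemma size_sortable_words n : size (sortable_words n) = 7 * 2 ^ n.
Proof. by rewrite !size_cat !size_map !size_bubble_words !expnS; lia. Qed.

(** * Permutations as words, and the count *)

Lemma word_inj n : injective (@word n).
Proof.
move=> x y /eq_in_map E; apply/permP => i; apply: val_inj; apply: E.
exact: mem_enum.
Qed.

Lemma perm_word n (x : 'S_n) : perm_eq (word x) (iota 0 n).
Proof.
rewrite -val_enum_ord /word (map_comp val x); apply: perm_map.
apply: uniq_perm; [|exact: enum_uniq|] => [|i].
  by rewrite map_inj_uniq ?enum_uniq //; exact: perm_inj.
rewrite mem_enum; apply/mapP; exists (x^-1 i)%g; rewrite ?mem_enum //.
by rewrite permKV.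
Qed.

Lemma word_surj n s : perm_eq s (iota 0 n) -> exists x : 'S_n, word x = s.
Proof.
move=> ps; have sz : size s = n by rewrite (perm_size ps) size_iota.
have lt (i : 'I_n) : nth 0 s i < n.
  have : nth 0 s i \in s by rewrite mem_nth ?sz.
  by rewrite (perm_mem ps) mem_iota.
have inj : injective (fun i => Ordinal (lt i)).
  move=> i j [] /eqP; rewrite nth_uniq ?sz ?(perm_uniq ps) ?iota_uniq //.
  by move/eqP/val_inj.
exists (perm inj); rewrite /word; apply: (@eq_from_nth _ 0).
  by rewrite size_map size_enum_ord sz.
move=> i; rewrite size_map size_enum_ord => ltin.
rewrite (nth_map (Ordinal ltin)) ?size_enum_ord // permE /=.
by rewrite nth_enum_ord.
Qed.

Lemma card_words n (L : seq (seq nat)) :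
  uniq L -> {in L, forall s, perm_eq s (iota 0 n)} ->
  #|[set x : 'S_n | word x \in L]| = size L.
Proof.
move=> uL pL; rewrite cardE -(size_map (@word n)); apply/perm_size/uniq_perm => //.
  by rewrite map_inj_uniq ?enum_uniq //; exact: word_inj.
move=> s; apply/mapP/idP => [[x]|sL]; first by rewrite mem_enum inE => xL ->.
have [x E] := word_surj (pL s sL).
by exists x; rewrite ?mem_enum ?inE E.
Qed.

Theorem theorem1p2 (n : nat) :
  4 <= n -> #|Sort_n n [:: 1; 2; 3] [:: 3; 2; 1]| = 7 * 2 ^ (n - 4).
Proof.
case: n => [|[|[|[|n]]]] // _; rewrite subSS !subSS subn0.
rewrite -size_sortable_words -(@card_words n.+4) ?uniq_sortable_words //; last first.
  exact: perm_sortable_words.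
apply: eq_card => x; rewrite !inE sT_mono.
have px := perm_word x.
rewrite west_sorts; last by rewrite (permPl (perm_run _ _ _)).
apply/idP/idP; [exact: no231_sortable_words | exact: sortable_words_no231].
Qed.
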